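(* Let $D=(V,A)$ be an acyclic digraph with $V\subset\mathbb{Z}^+$, $|V|=n\ge 3$, let $a\in V$, and let $m\in\mathbb{Z}^+\setminus V$ satisfy $m>y$ for all $y\in V\setminus R_D[a]$. Then $$\Delta(D,z)-\Delta(D_{a\rightarrow m},z)=(z-1)^2\sum_{\pi_0\in\mathcal{OP}(D-a)}\left[p(a,\pi_0)+|Q(a,\pi_0)|z^{-1}\right]z^{\delta_{D-a}(\pi_0)}.$$
   Context: $R_D(a)$ is the set of vertices $v\ne a$ reachable from $a$ by a directed path, and $R_D[a]=R_D(a)\cup\{a\}$. $D_{a\rightarrow m}$ is the digraph obtained from $D$ by relabeling the vertex $a$ as $m$ (arcs kept); $D-a$ is obtained by deleting $a$. For an acyclic digraph $H$ whose vertex set is a set of $k$ positive integers: $\mathcal{OP}(H)$ is the set of orderings $(u_1,\dots,u_k)$ of its vertices such that $(u_i,u_j)$ an arc implies $i<j$; $\delta_H(b,c)=1$ if $b<c$ or $(b,c)$ is an arc of $H$, else $0$; $\delta_H((u_1,\dots,u_k))=\sum_{i=1}^{k-1}\delta_H(u_i,u_{i+1})$; $\Delta(H,z)=\sum_{\pi\in\mathcal{OP}(H)}z^{\delta_H(\pi)}$. For $\pi_0=(a_1,\dots,a_{n-1})\in\mathcal{OP}(D-a)$: let $s=0$ if $a$ has no in-neighbour, else $s=\max\{1\le k\le n-1:(a_k,a)\in A\}$; let $t=n$ if $a$ has no out-neighbour, else $t=\min\{1\le k\le n-1:(a,a_k)\in A\}$ (then $s<t$). Adopt the conventions $\delta_D(a_0,a_1)=\delta_D(a_0,a)=\delta_D(a_{n-1},a_n)=\delta_D(a,a_n)=1$,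 and a product in which a factor equals $0$ is $0$ even if another factor is undefined. Define $Q(a,\pi_0)=\{i: s+1\le i\le t-2,\ a_i>a>a_{i+1},\ (a_i,a_{i+1})\in A\}$ and $p(a,\pi_0)=(1-\delta_D(a_s,a_{s+1}))\delta_D(a,a_{s+1})-(1-\delta_D(a_{t-1},a_t))\delta_D(a,a_{t-1})$.
   Formalization: The parenthetical ''(then s<t)'' does not follow from acyclicity, and the identity fails without it (arcs 6→8→3, a=8, m=9: left side 0, right side (z-1)^2); s<t for every π_0 in OP(D-a) is therefore taken as a hypothesis. *)

(* Defs.v *)
From HB Require Import structures.
From mathcomp Require Export all_boot all_order all_algebra.
From mathcomp Require Export finmap.

Set Implicit Arguments.
Unset Strict Implicit.
Unset Printing Implicit Defensive.

Import GRing.Theory.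

Local Open Scope fset_scope.

Record digraph := Digraph {
  verts : {fset nat};
  arcs : {fset nat * nat}
}.

Definition arc (D : digraph) : rel nat := fun u v => (u, v) \in arcs D.

Definition is_digraph (D : digraph) : Prop :=
  forall u v, arc D u v -> u \in verts D /\ v \in verts D.

(* [ucycle] asks for pairwise distinct vertices; one-vertex cycles are loops. *)
Definition acyclic (D : digraph) : Prop :=
  forall c : seq nat, ucycle (arc D) c -> c = [::].

Definition reach_open (D : digraph) (a v : nat) : Prop :=
  v <> a /\ exists2 w : seq nat, path (arc D) a w & last a w = v.

Definition reach_closed (D : digraph) (a v : nat) : Prop :=
  reach_open D a v \/ v = a.

Definition relabel_vertex (a m v : nat) : nat := if v == a then m else v.

Definition relabel (D : digraph) (a m : nat) : digraph :=
  Digraph [fset relabel_vertex a m v | v in verts D]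
          [fset (relabel_vertex a m e.1, relabel_vertex a m e.2) | e in arcs D].

Definition del_vertex (D : digraph) (a : nat) : digraph :=
  Digraph (verts D `\ a) [fset e in arcs D | (e.1 != a) && (e.2 != a)].

Definition order_preserving (H : digraph) (u : seq nat) : bool :=
  [forall i : 'I_(size u), forall j : 'I_(size u),
     arc H (nth 0 u i) (nth 0 u j) ==> (i < j)].

(* [permutations] is duplicate-free, so each ordering is listed once. *)
Definition OP (H : digraph) : seq (seq nat) :=
  [seq u <- permutations (enum_fset (verts H)) | order_preserving H u].

Definition delta (H : digraph) (b c : nat) : nat := (b < c) || arc H b c.

Definition delta_seq (H : digraph) (u : seq nat) : nat :=
  \sum_(0 <= i < (size u).-1) delta H (nth 0 u i) (nth 0 u i.+1).

Definition Delta (H : digraph) : {poly int} :=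
  (\sum_(u <- OP H) 'X^(delta_seq H u))%R.

(* In the rest of the file, [u] is the ordering (a_1, ..., a_(n-1)) of the
   vertices other than [a], so that n = (size u).+1; [entry u k] is a_k and is
   meaningful only for 1 <= k <= n - 1. *)
Definition entry (u : seq nat) (k : nat) : nat := nth 0 u k.-1.

Definition pos_s (D : digraph) (a : nat) (u : seq nat) : nat :=
  \max_(1 <= k < (size u).+1 | arc D (entry u k) a) k.

Definition pos_t (D : digraph) (a : nat) (u : seq nat) : nat :=
  \big[minn/(size u).+1]_(1 <= k < (size u).+1 | arc D a (entry u k)) k.

(* delta_D (a_k, a_(k+1)) for 0 <= k <= n - 1, with the conventions
   delta_D (a_0, a_1) = delta_D (a_(n-1), a_n) = 1. *)
Definition delta_gap (D : digraph) (u : seq nat) (k : nat) : nat :=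
  if (k == 0) || (k == size u) then 1 else delta D (entry u k) (entry u k.+1).

(* delta_D (a, a_k) for 1 <= k <= n, with the convention delta_D (a, a_n) = 1.
   The value at k = 0 is junk: in [p_coef] it occurs only when t = 1, where it
   is multiplied by 1 - delta_D (a_0, a_1) = 0. *)
Definition delta_from (D : digraph) (a : nat) (u : seq nat) (k : nat) : nat :=
  if k == (size u).+1 then 1 else delta D a (entry u k).

Definition Q_set (D : digraph) (a : nat) (u : seq nat) : {set 'I_(size u).+1} :=
  [set i : 'I_(size u).+1 |
    [&& (pos_s D a u).+1 <= i, i.+2 <= pos_t D a u,
        a < entry u i, entry u i.+1 < a & arc D (entry u i) (entry u i.+1)]].

Definition p_coef (D : digraph) (a : nat) (u : seq nat) : int :=
  let s := pos_s D a u in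
  let t := pos_t D a u in
  ((1 - (delta_gap D u s)%:Z) * (delta_from D a u s.+1)%:Z
   - (1 - (delta_gap D u t.-1)%:Z) * (delta_from D a u t.-1)%:Z)%R.

(* s < t for every ordering of D - a.  Acyclicity does not imply this: it fails
   as soon as b -> a -> c are arcs with no directed path from b to c avoiding
   a.  The identity for Delta needs it: for the arcs 6 -> 8 -> 3, a = 8 and
   m = 9, Delta D = Delta (relabel D a m) = z^2, whereas the right-hand side
   is (z - 1)^2. *)
Definition s_lt_t (D : digraph) (a : nat) : Prop :=
  forall u, u \in OP (del_vertex D a) -> pos_s D a u < pos_t D a u.

(* Main.v *)
(* Removing [a] from an ordering of [D] leaves an ordering [u] of [D - a], and
   [a] can be put back exactly into the gaps k = s, ..., t - 1 between a_k and
   a_(k+1).  The same gaps serve for the relabelled vertex [m], which exceeds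
   every a_i with i < t, because such an a_i is not reachable from [a].  So both
   polynomials are sums over the same pairs (u, k), and for fixed [u] the
   differences of the gap contributions are (z - 1) times a telescoping sum,
   up to (z - 1)^2 / z for each element of Q and boundary terms at the gaps s
   and t - 1, which combine into (z - 1)^2 p. *)
Require Import Defs.
From mathcomp Require Import all_boot all_order all_algebra finmap.
From mathcomp Require Import zify ring.
Import GRing.Theory.
Local Open Scope fset_scope.
Local Open Scope ring_scope.

(* [path.arc] would otherwise shadow the arc relation of a digraph. *)
Local Notation arc := Defs.arc.

(** * Order-preserving sequences and the bounds s and t *)

Lemma order_preserving_ltn (H : digraph) (u : seq nat) (i j : nat) :
  order_preserving H u -> (i < size u)%N -> (j < size u)%N ->
  arc H (nth 0%N u i) (nth 0%N u j) -> (i < j)%N.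
Proof.
move=> /forallP op iu ju.
by move/forallP: (op (Ordinal iu)) => /(_ (Ordinal ju)) /implyP.
Qed.

(** [pairwise] splits along concatenations, which is what inserting a vertex calls for. It compares
    distinct positions only, so loops are excluded separately. *)
Lemma order_preservingE (H : digraph) (u : seq nat) :
  order_preserving H u =
  all (fun x => ~~ arc H x x) u && pairwise (fun x y => ~~ arc H y x) u.
Proof.
apply/idP/andP => [/order_preserving_ltn op |
                   [/(all_nthP 0%N) loopless /(pairwiseP 0%N) pw]].
  split.
    by apply/(all_nthP 0%N) => i iu; apply/negP => /(op _ _ iu iu); lia.
  by apply/(pairwiseP 0%N) => i j iu ju ij; apply/negP => /(op _ _ ju iu); lia.
apply/forallP => i; apply/forallP => j; apply/implyP => aij.
rewrite ltnNge; apply/negP; rewrite leq_eqVlt => /orP[/eqP ji | ji].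
  by move: (loopless i (ltn_ord i)) => /negP; apply; rewrite -{2}ji.
by move: (pw j i (ltn_ord j) (ltn_ord i) ji); rewrite aij.
Qed.

(** [entry] counts from 1 and [nth] from 0: [nth 0 u j] is a_(j+1), so [k <= j] describes the
    entries to the right of gap k. *)
Lemma pos_s_leP (D : digraph) (a k : nat) (u : seq nat) :
  reflect (forall j, (k <= j < size u)%N -> ~~ arc D (nth 0%N u j) a)
          (pos_s D a u <= k)%N.
Proof.
apply: (iffP (bigmax_leqP_seq _ _ _ _)) => [h j jk | h [|j]].
- apply/negP => aj; have := h j.+1; rewrite mem_index_iota /entry /=.
  by move=> /(_ _ aj); lia.
- by rewrite mem_index_iota.
rewrite mem_index_iota /entry /= => ju aj; rewrite ltnNge; apply/negP => kj.
by move: (h j); rewrite kj aj; lia.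
Qed.

Lemma ltn_bigmin (k x : nat) (r : seq nat) (P : pred nat) :
  (k < \big[minn/x]_(i <- r | P i) i)%N =
  (k < x)%N && all (fun i => P i ==> (k < i)%N) r.
Proof.
elim: r => [|i r IHr]; first by rewrite big_nil andbT.
by rewrite big_cons /=; case: (P i) => //=; rewrite leq_min IHr andbCA.
Qed.

(** [k <= size u] keeps k below n = [(size u).+1], the value to which the minimum defaults. *)
Lemma pos_t_gtP (D : digraph) (a k : nat) (u : seq nat) : (k <= size u)%N ->
  reflect (forall j, (j < k)%N -> ~~ arc D a (nth 0%N u j))
          (k < pos_t D a u)%N.
Proof.
move=> ku; rewrite /pos_t ltn_bigmin ltnS ku /=.
apply: (iffP allP) => [h j jk | h [|j]].
- have := h j.+1; rewrite mem_index_iota /entry /= => /(_ _)/implyP aj.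
  by apply/negP => /aj; lia.
- by rewrite mem_index_iota.
rewrite mem_index_iota /entry /= => ju; apply/implyP => aj.
rewrite ltnS leqNgt; apply/negP => /h; by rewrite aj.
Qed.

Lemma pos_t_le_size (D : digraph) (a : nat) (u : seq nat) :
  (pos_t D a u <= (size u).+1)%N.
Proof. by rewrite leqNgt /pos_t ltn_bigmin ltnn. Qed.

Lemma pos_s_arc (D : digraph) (a : nat) (u : seq nat) :
  (0 < pos_s D a u)%N -> arc D (nth 0%N u (pos_s D a u).-1) a.
Proof.
move=> s_gt0; apply: contraT => no_arc.
suff: (pos_s D a u <= (pos_s D a u).-1)%N by lia.
apply/pos_s_leP => j; rewrite leq_eqVlt => /andP[/orP[/eqP <- // | sj] ju].
by have /pos_s_leP := leqnn (pos_s D a u); apply; lia.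
Qed.

Lemma pos_t_gt0 (D : digraph) (a : nat) (u : seq nat) : (0 < pos_t D a u)%N.
Proof. by apply/pos_t_gtP. Qed.

Lemma pos_t_arc (D : digraph) (a : nat) (u : seq nat) :
  (pos_t D a u <= size u)%N -> arc D a (nth 0%N u (pos_t D a u).-1).
Proof.
move=> tu; apply: contraT => no_arc; have t_gt0 := pos_t_gt0 D a u.
suff: (pos_t D a u < pos_t D a u)%N by rewrite ltnn.
apply/pos_t_gtP => // j jt.
have [/eqP -> // | j_neq] := boolP (j == (pos_t D a u).-1).
have t1u : ((pos_t D a u).-1 <= size u)%N by lia.
have /(pos_t_gtP D a _ u t1u) : ((pos_t D a u).-1 < pos_t D a u)%N by lia.
by apply; lia.
Qed.

(** * Inserting a vertex into an ordering *)

Definition insert (k x : nat) (u : seq nat) := take k u ++ x :: drop k u.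

Lemma arc_del (H : digraph) (x y z : nat) : y != x -> z != x ->
  arc (del_vertex H x) y z = arc H y z.
Proof. by move=> yx zx; rewrite /arc /= !inE /= yx zx !andbT. Qed.

Lemma perm_insert (k x : nat) (u : seq nat) : perm_eq (insert k x u) (x :: u).
Proof. by rewrite /insert -cat1s perm_catCA cat1s perm_cons cat_take_drop. Qed.

(** Besides the constraints inside [u], only those at [x] remain: no arc from [x] to the first k
    entries, which is k < t, and no arc to [x] from the later ones, which is s <= k. *)
Lemma order_preserving_insert (H : digraph) (k x : nat) (u : seq nat) :
  ~~ arc H x x -> x \notin u -> (k <= size u)%N ->
  order_preserving H (insert k x u) =
  order_preserving (del_vertex H x) u && (pos_s H x u <= k < pos_t H x u)%N.
Proof.
move=> xx xu ku; rewrite !order_preservingE (perm_all _ (perm_insert _ _ _)) /= xx /=.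
have del_arc y z : y \in u -> z \in u -> arc (del_vertex H x) y z = arc H y z.
  by move=> yu zu; apply: arc_del; apply: contraNneq xu => <-.
have -> : all (fun y => ~~ arc (del_vertex H x) y y) u = all (fun y => ~~ arc H y y) u.
  by apply: eq_in_all => y yu; rewrite del_arc.
have -> : pairwise (fun y z => ~~ arc (del_vertex H x) z y) u =
          pairwise (fun y z => ~~ arc H z y) u.
  apply: (@eq_in_pairwise _ (mem u)); last exact/allP.
  by move=> y z yu zu /=; rewrite del_arc.
have -> : (pos_s H x u <= k)%N = all (fun y => ~~ arc H y x) (drop k u).
  apply/pos_s_leP/(all_nthP 0%N) => h j.
    by rewrite size_drop nth_drop => jk; apply: h; lia.
  move=> jk; have := h (j - k)%N; rewrite size_drop nth_drop.
  by rewrite subnKC; [apply; lia | lia].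
have -> : (k < pos_t H x u)%N = all (fun y => ~~ arc H x y) (take k u).
  apply/(pos_t_gtP _ _ _ _ ku)/(all_nthP 0%N) => h j.
    by rewrite size_take_min => jk; rewrite nth_take; [apply: h |]; lia.
  by move=> jk; have := h j; rewrite size_take_min nth_take //; apply; lia.
rewrite -andbA; congr andb.
rewrite -[u in RHS](cat_take_drop k u) /insert !pairwise_cat allrel_consr /=.
rewrite cat_take_drop -!andbA.
case: (all _ (take k u)); case: (all _ (drop k u)); rewrite ?andbF ?andbT //=.
Qed.

Lemma mem_OP (H : digraph) (u : seq nat) :
  (u \in OP H) = perm_eq u (enum_fset (verts H)) && order_preserving H u.
Proof. by rewrite mem_filter mem_permutations andbC. Qed.

Lemma perm_cons_del (H : digraph) (x : nat) : x \in verts H ->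
  perm_eq (x :: enum_fset (verts (del_vertex H x))) (enum_fset (verts H)).
Proof.
move=> xV; apply: uniq_perm; rewrite ?fset_uniq //=.
  by rewrite fset_uniq andbT !inE eqxx.
by move=> y; rewrite !inE; case: eqP => // ->.
Qed.

Lemma mem_OP_del (H : digraph) (x : nat) (u : seq nat) :
  u \in OP (del_vertex H x) -> u =i verts (del_vertex H x).
Proof. by rewrite mem_OP => /andP[/perm_mem]. Qed.

Lemma notin_OP_del (H : digraph) (x : nat) (u : seq nat) :
  u \in OP (del_vertex H x) -> x \notin u.
Proof. by move/mem_OP_del->; rewrite !inE eqxx. Qed.

Lemma index_insert (k x : nat) (u : seq nat) :
  (k <= size u)%N -> x \notin u -> index x (insert k x u) = k.
Proof.
move=> ku xu; have xt : x \notin take k u by apply: contraNN xu; apply: mem_take.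
by rewrite index_pivot // size_takel.
Qed.

Lemma rem_insert (k x : nat) (u : seq nat) :
  (k <= size u)%N -> x \notin u -> rem x (insert k x u) = u.
Proof.
move=> ku xu; rewrite remE index_insert // /insert.
have sk : size (take k u) = k by rewrite size_takel; lia.
rewrite take_size_cat // -cat_rcons drop_size_cat ?cat_take_drop //.
by rewrite size_rcons sk.
Qed.

(** The map (u, k) to [insert k x u] is a bijection onto the orderings of [H]; its inverse sends w
    to ([rem x w], [index x w]). *)
Lemma sum_OP_insert (V : nmodType) (H : digraph) (x : nat) (F : seq nat -> V) :
  ~~ arc H x x -> x \in verts H ->
  \sum_(w <- OP H) F w =
  \sum_(u <- OP (del_vertex H x))
    \sum_(pos_s H x u <= k < pos_t H x u) F (insert k x u).
Proof.
move=> xx xV; rewrite -(big_allpairs_dep (h := fun u k => insert k x u)).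
have ok (u : seq nat) (k : nat) : u \in OP (del_vertex H x) ->
    k \in index_iota (pos_s H x u) (pos_t H x u) -> (k <= size u)%N /\ x \notin u.
  move=> uO; rewrite mem_index_iota => kst; split; last exact: notin_OP_del uO.
  by have := pos_t_le_size H x u; lia.
apply/perm_big/uniq_perm.
- exact/filter_uniq/permutations_uniq.
- apply: allpairs_uniq_dep.
  + exact/filter_uniq/permutations_uniq.
  + by move=> u _; apply: iota_uniq.
  move=> p q /allpairsPdep[u [k [uO kI ->]]] /allpairsPdep[v [l [vO lI ->]]] /=.
  have [ku xu] := ok _ _ uO kI; have [lv xv] := ok _ _ vO lI.
  move=> e; have <- : u = v by rewrite -(rem_insert _ _ _ ku xu) e rem_insert.
  by have -> : k = l by rewrite -(index_insert _ _ _ ku xu) e index_insert.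
move=> w; apply/idP/allpairsPdep => [| [u [k [uO kI ->]]]]; last first.
  have [ku xu] := ok _ _ uO kI; move: uO kI.
  rewrite !mem_OP order_preserving_insert // mem_index_iota => /andP[pu ->] ->.
  rewrite andbT (perm_trans (perm_insert _ _ _)) //.
  by apply: perm_trans (perm_cons_del _ _ xV); rewrite perm_cons.
rewrite mem_OP => /andP[pw ow].
have xw : x \in w by rewrite (perm_mem pw).
have w_uniq : uniq w by rewrite (perm_uniq pw) fset_uniq.
have kw : (index x w < size w)%N by rewrite index_mem.
have sr : size (rem x w) = (size w).-1 by rewrite size_rem.
have ku : (index x w <= size (rem x w))%N by lia.
have xu : x \notin rem x w by rewrite mem_rem_uniq // !inE eqxx.
have wE : insert (index x w) x (rem x w) = w.
  rewrite /insert remE.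
  have st : size (take (index x w) w) = index x w by rewrite size_takel; lia.
  rewrite take_size_cat // drop_size_cat //.
  by have := drop_nth 0%N kw; rewrite nth_index // => <-; rewrite cat_take_drop.
move: ow; rewrite -wE order_preserving_insert // => /andP[ou kst].
exists (rem x w), (index x w); split=> //; last by rewrite mem_index_iota.
rewrite mem_OP ou andbT -(perm_cons x).
by rewrite -(permPl (perm_to_rem xw)) (perm_trans pw) // perm_sym perm_cons_del.
Qed.

(** * Effect of an insertion on [delta_seq] *)

(* The counterpart of [delta_from], with the convention delta_D (a_0, a) = 1. *)
Definition delta_into (D : digraph) (x : nat) (u : seq nat) (k : nat) : nat :=
  if k == 0%N then 1%N else delta D (entry u k) x.

Lemma delta_seq_cat (H : digraph) (x y : nat) (u v : seq nat) :
  delta_seq H (rcons u x ++ y :: v) =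
  (delta_seq H (rcons u x) + delta H x y + delta_seq H (y :: v))%N.
Proof.
elim: u => [|z u IHu] /=.
  rewrite /delta_seq /= big_nat_recl // [X in (X + _ + _)%N]big_geq //.
have cons_seq c w : (0 < size w)%N ->
    delta_seq H (c :: w) = (delta H c (nth 0%N w 0) + delta_seq H w)%N.
  by case: w => // d w _; rewrite /delta_seq /= big_nat_recl.
rewrite cons_seq ?size_cat ?size_rcons // IHu nth_cat size_rcons /=.
by rewrite [delta_seq H (z :: _)]cons_seq ?size_rcons // !addnA.
Qed.

(* [u] has to be nonempty for the conventions at the two ends to agree. *)
Lemma delta_seq_insert (H : digraph) (k x : nat) (u : seq nat) :
  (0 < size u)%N -> (k <= size u)%N ->
  (delta_seq H (insert k x u) + delta_gap H u k =
   delta_seq H u + (delta_into H x u k + delta_from H x u k.+1))%N.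
Proof.
move=> u_gt0 ku; rewrite /insert /delta_gap /delta_into /delta_from eqSS.
have cat1 y c w : delta_seq H (y :: c :: w) = (delta H y c + delta_seq H (c :: w))%N.
  by rewrite /delta_seq /= big_nat_recl.
case: k ku => [|k] ku /=.
  rewrite take0 drop0; case: u u_gt0 ku => // y u _ _ /=.
  by rewrite cat1 /entry /=; lia.
have sk : size (take k u) = k by rewrite size_takel; lia.
rewrite (take_nth 0%N) //; have [ku' | ku'] := eqVneq k.+1 (size u).
  (* Last gap: [x] is appended, and the conventional values 1 of [delta_gap] and [delta_from]
     cancel. *)
  have uE : rcons (take k u) (nth 0%N u k) = u by rewrite -take_nth // ku' take_size.
  rewrite [drop _ _]drop_oversize ?ku' // delta_seq_cat uE /entry -ku' /=.
  by rewrite [delta_seq H [:: x]]big_geq //; lia.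
have uE : u = rcons (take k u) (nth 0%N u k) ++ nth 0%N u k.+1 :: drop k.+2 u.
  by rewrite -drop_nth; [rewrite -take_nth // cat_take_drop | lia].
have := congr1 (delta_seq H) uE; rewrite delta_seq_cat => ->.
rewrite (drop_nth 0%N); last lia.
by rewrite delta_seq_cat cat1 /entry /=; lia.
Qed.

(** * The telescoping identity over the gaps *)

(* [L k], [R k], [d k] stand for delta (a_k, a), delta (a, a_(k+1)) and
   delta (a_k, a_(k+1)); for [m] instead of [a] the first two are 1 and
   [k == t.-1]. *)
Lemma gap_sum_diff (F : fieldType) (z : F) (s t : nat) (L R d : nat -> bool) :
  z != 0 -> (s.+1 < t)%N -> L s -> R t.-1 ->
  (forall k, (s < k < t)%N -> L k = ~~ R k.-1) ->
  (forall k, (s < k < t.-1)%N -> L k -> R k -> d k) ->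
  \sum_(s <= k < t) z ^+ (L k + R k) / z ^+ d k
  - \sum_(s <= k < t) z ^+ (1 + (k == t.-1)) / z ^+ d k =
  (z - 1) ^+ 2 *
  ((1 - (d s)%:R) * (R s)%:R - (1 - (d t.-1)%:R) * (R t.-2)%:R
   + (\sum_(s.+1 <= k < t.-1) (~~ L k && ~~ R k && d k))%:R / z).
Proof.
case: t => [|[|t]] // z0; rewrite !ltnS /= => st Ls Rt LR Ld.
(* The extreme gaps t - 1 and s are split off; the telescoping takes place strictly between them. *)
rewrite -sumrB big_nat_recr /=; last lia.
rewrite big_ltn // eqxx Ls Rt.
have Lt : L t.+1 = ~~ R t by rewrite LR //=; lia.
have -> : (s == t.+1) = false by apply/negbTE; lia.
(* Since R k = 1 - L (k+1), the main term L k + R k - 1 is L k - L (k+1). The correction (z - 1)^2 /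
   z occurs when L k and R k fail but d k holds; the hypothesis [Ld] rules out L k and R k without d
   k. *)
have step k : (s < k < t.+1)%N ->
    z ^+ (L k + R k) / z ^+ d k - z ^+ (1 + (k == t.+1)) / z ^+ d k =
    (z - 1) * - ((L k.+1)%:R - (L k)%:R) +
    (z - 1) ^+ 2 / z * (~~ L k && ~~ R k && d k)%:R.
  move=> kst; have -> : (k == t.+1) = false by apply/negbTE; lia.
  have -> : L k.+1 = ~~ R k by rewrite LR //=; lia.
  have : L k -> R k -> d k by apply: Ld; lia.
  case: (L k); case: (R k); case: (d k) => //= h;
    first [by have := h isT isT |
      by rewrite ?(addn0, add0n, addn1, expr0, expr1, divr1) /=; field].
rewrite (eq_big_nat _ _ step) big_split /= -!mulr_sumr sumrN.
(* The ends of the telescope become R s and R (t-2) of the statement, leaving a finite check on R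
   and d at the extreme gaps. *)
rewrite telescope_sumr // Lt LR /=; last lia.
rewrite -natr_sum; move: (\sum_(_ <= _ < _) _)%N => q.
case: (R s); case: (R t); case: (d s); case: (d t.+1) => /=;
  rewrite ?(addn0, add0n, addn1, expr0, expr1, divr1) /=; by field.
Qed.

(** * Relabelling and deletion *)

(** [relabel_vertex a m] sends both [a] and [m] to [m], so it is injective only away from [m]; hence
    the conditions on [x] and [y]. *)
Lemma arc_relabel (D : digraph) (a m x y : nat) :
  is_digraph D -> m \notin verts D -> x != m -> y != m ->
  arc (relabel D a m) (relabel_vertex a m x) (relabel_vertex a m y) = arc D x y.
Proof.
move=> Dd mV xm ym.
have inj v w : v != m -> w != m -> relabel_vertex a m v = relabel_vertex a m w -> v = w.
  rewrite /relabel_vertex.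
  have [->|_] := eqVneq v a; have [->|_] := eqVneq w a => // vm wm e.
    by rewrite -e eqxx in wm.
  by rewrite e eqxx in vm.
apply/imfsetP/idP => /= [[[v w] vw [/inj xv /inj yw]] | xy]; last by exists (x, y).
have [vV wV] := Dd v w vw.
have vm : v != m by apply: contraNneq mV => <-.
have wm : w != m by apply: contraNneq mV => <-.
by rewrite (xv xm vm) (yw ym wm).
Qed.

(** This makes both polynomials sums over the same orderings [u]. *)
Lemma del_relabel (D : digraph) (a m : nat) :
  is_digraph D -> m \notin verts D -> a \in verts D ->
  del_vertex (relabel D a m) m = del_vertex D a.
Proof.
move=> Dd mV aV; have am : a != m by apply: contraNneq mV => <-.
have rvE v : v != a -> relabel_vertex a m v = v.
  by rewrite /relabel_vertex => /negbTE ->.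
have rva : relabel_vertex a m a = m by rewrite /relabel_vertex eqxx.
congr Digraph; apply/fsetP.
  move=> y; rewrite !in_fsetD1; apply/andP/andP => -[].
    move=> ym /imfsetP[v /= vV]; rewrite /relabel_vertex; case: eqP => [_ e|va ->].
      by rewrite e eqxx in ym.
    by split=> //; apply/eqP.
  move=> ya yV; split; first by apply: contraNneq mV => <-.
  by apply/imfsetP; exists y => //; rewrite rvE.
move=> [x y]; rewrite !in_fset /=; apply/andP/andP => -[].
  move=> /imfsetP[[v w] /= vw [-> ->]].
  have [->|va] := eqVneq v a; first by rewrite rva eqxx.
  have [->|wa] := eqVneq w a; first by rewrite rva eqxx andbF.
  by rewrite !rvE // va wa => _; split.
move=> xy /andP[xa ya]; have [xV yV] := Dd _ _ xy.
split; first by apply/imfsetP; exists (x, y) => //=; rewrite !rvE.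
by apply/andP; split; apply: contraNneq mV => <-.
Qed.

Lemma nth_neq (x i : nat) (u : seq nat) :
  x \notin u -> (i < size u)%N -> nth 0%N u i != x.
Proof. by move=> xu iu; apply: contraNneq xu => <-; apply: mem_nth. Qed.

Lemma delta_seq_del (H : digraph) (x : nat) (u : seq nat) : x \notin u ->
  delta_seq (del_vertex H x) u = delta_seq H u.
Proof.
move=> xu; apply: eq_big_nat => i iu; rewrite /delta arc_del //.
all: by apply: nth_neq => //; lia.
Qed.

Lemma delta_gap_del (H : digraph) (x k : nat) (u : seq nat) : x \notin u ->
  (k <= size u)%N -> delta_gap (del_vertex H x) u k = delta_gap H u k.
Proof.
move=> xu ku; rewrite /delta_gap; case: k ku => //= k ku.
case: eqP => // kN; rewrite /delta arc_del //.
all: by apply: nth_neq => //; lia.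
Qed.

(** * Orderings of D - a: reachability from [a], and the case t = s + 1 *)

(* A path from [a] that avoids [a] afterwards enters [u] at position [t] or
   later, and then moves forward in [u]. *)
Lemma not_reach_before_t (D : digraph) (a : nat) (u : seq nat) (j : nat) :
  is_digraph D -> u \in OP (del_vertex D a) -> (j.+1 < pos_t D a u)%N ->
  ~ reach_closed D a (nth 0%N u j).
Proof.
move=> Dd uO jt.
have ju : (j < size u)%N by have := pos_t_le_size D a u; lia.
have au := notin_OP_del _ _ _ uO.
have u_uniq : uniq u.
  by move: uO; rewrite mem_OP => /andP[/perm_uniq -> _]; apply: fset_uniq.
have ja : nth 0%N u j != a by apply: nth_neq.
have mem_u (v : nat) : v \in verts D -> v != a -> v \in u.
  by move=> vV va; rewrite (mem_OP_del _ _ _ uO) /= in_fsetD1 va.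
case=> [[_ [w wp wl]] | /eqP]; last by rewrite (negbTE ja).
(* A path without repetition never returns to [a], so all its later vertices lie in [u]. *)
move: wl; case/shortenP: wp => w' wp' w_uniq _ wl.
have far (v : nat) (p : seq nat) : path (arc D) v p -> a \notin p -> v \in u ->
    ((pos_t D a u).-1 <= index v u)%N -> ((pos_t D a u).-1 <= index (last v p) u)%N.
  elim: p v => //= y p IHp v /andP[vy yp]; rewrite inE negb_or => /andP[ya ap] vu tv.
  have yu : y \in u by apply: mem_u; [case: (Dd _ _ vy) | rewrite eq_sym].
  apply: IHp => //; apply: leq_trans tv _; apply: ltnW.
  have ou : order_preserving (del_vertex D a) u by move: uO; rewrite mem_OP => /andP[].
  apply: (order_preserving_ltn _ _ _ _ ou); rewrite ?index_mem //.
  rewrite !nth_index // arc_del //.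
    by apply: contraNneq au => <-.
  by rewrite eq_sym.
case: w' wp' w_uniq wl => [_ _ /= e | y p /= /andP[ay yp] /andP[ayp _] wl].
  by rewrite -e eqxx in ja.
move: ayp; rewrite inE negb_or eq_sym => /andP[ya ap].
have yu : y \in u by apply: mem_u => //; case: (Dd _ _ ay).
suff : ((pos_t D a u).-1 <= index (last y p) u)%N.
  by rewrite wl index_uniq //; lia.
(* The first vertex [y] of the path is an out-neighbour of [a], so its index counted from 0 is at
   least t - 1. *)
apply: far => //; rewrite leqNgt; apply/negP => yt.
have /pos_t_gtP : ((index y u).+1 < pos_t D a u)%N by lia.
by rewrite index_mem => /(_ yu _ (ltnSn _)); rewrite nth_index // ay.
Qed.

(* Otherwise exchanging the neighbours [a_s] and [a_t] would give an ordering
   of [D - a] with [t < s]. *)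
Lemma arc_across (D : digraph) (a : nat) (u : seq nat) :
  s_lt_t D a -> u \in OP (del_vertex D a) -> pos_t D a u = (pos_s D a u).+1 ->
  (0 < pos_s D a u < size u)%N ->
  arc D (nth 0%N u (pos_s D a u).-1) (nth 0%N u (pos_s D a u)).
Proof.
move=> st uO ts su; have au := notin_OP_del _ _ _ uO.
have sa : arc D (nth 0%N u (pos_s D a u).-1) a by apply: pos_s_arc; lia.
have at' : arc D a (nth 0%N u (pos_s D a u)).
  by have := pos_t_arc D a u; rewrite ts; apply; lia.
move: su sa at'; set s := pos_s D a u; case: s => // s /=.
move=> su sa at'; apply: contraT => no_arc.
(* From here [s] is [(pos_s D a u).-1], so [b] is a_s and [c] is a_t in the original notation. *)
set b := nth 0%N u s in sa no_arc *; set c := nth 0%N u s.+1 in at' no_arc *.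
set l := take s u; set r := drop s.+2 u.
have sl : size l = s by rewrite size_takel; lia.
have uE : u = l ++ b :: c :: r.
  by rewrite /c /r -drop_nth ?/b -?drop_nth ?cat_take_drop //; lia.
have bu : b != a by apply: nth_neq => //; lia.
have cu : c != a by apply: nth_neq => //; lia.
set u' := l ++ c :: b :: r.
have u'u : perm_eq u' u.
  by rewrite uE perm_cat2l -[c :: _]cat1s -[b :: _]cat1s perm_catCA.
(* Only [b] and [c] change their relative order, and there is no arc from [b] to [c]. *)
have u'O : u' \in OP (del_vertex D a).
  move: uO; rewrite !mem_OP => /andP[pu ou]; rewrite (perm_trans u'u pu) /=.
  move: ou; rewrite !order_preservingE (perm_all _ u'u) => /andP[-> /=].
  rewrite uE !pairwise_cat !allrel_consr /= (arc_del _ _ b c) // no_arc.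
  move=> /and3P[/and3P[-> -> ->] -> /and3P[/andP[_ ->] -> ->]] //.
(* In [u'] the out-neighbour [c] is entry [s.+1] and the in-neighbour [b] is entry [s.+2], against
   [st]. *)
have su' : (s.+1 < pos_s D a u')%N.
  rewrite ltnNge; apply/pos_s_leP => /(_ s.+1).
  rewrite (perm_size u'u) leqnn su nth_cat sl ltnNge leqnSn /= subSnn /= sa.
  by move=> /(_ isT).
have tu' : (pos_t D a u' <= s.+1)%N.
  rewrite leqNgt; apply/negP => /pos_t_gtP.
  rewrite (perm_size u'u) => /(_ _ s (ltnSn s)).
  by rewrite nth_cat sl ltnn subnn /= at' => /(_ (ltnW su)).
by have := st _ u'O; lia.
Qed.

(** * The gaps open to the relabelled vertex *)

Lemma pos_s_relabel (D : digraph) (a m : nat) (u : seq nat) :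
  is_digraph D -> m \notin verts D -> a \in verts D ->
  u \in OP (del_vertex D a) -> pos_s (relabel D a m) m u = pos_s D a u.
Proof.
move=> Dd mV aV uO; rewrite /pos_s big_nat_cond [RHS]big_nat_cond.
apply: eq_bigl => k; apply: andb_id2l => ku.
have : entry u k \in u by apply: mem_nth; case: k ku.
rewrite (mem_OP_del _ _ _ uO) in_fsetD1 => /andP[ka kV].
rewrite -(arc_relabel D a m _ _ Dd mV) /relabel_vertex ?(negbTE ka) ?eqxx //.
all: by apply: contraNneq mV => <-.
Qed.

Lemma pos_t_relabel (D : digraph) (a m : nat) (u : seq nat) :
  is_digraph D -> m \notin verts D -> a \in verts D ->
  u \in OP (del_vertex D a) -> pos_t (relabel D a m) m u = pos_t D a u.
Proof.
move=> Dd mV aV uO; rewrite /pos_t big_nat_cond [RHS]big_nat_cond.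
apply: eq_bigl => k; apply: andb_id2l => ku.
have : entry u k \in u by apply: mem_nth; case: k ku.
rewrite (mem_OP_del _ _ _ uO) in_fsetD1 => /andP[ka kV].
rewrite -(arc_relabel D a m _ _ Dd mV) /relabel_vertex ?(negbTE ka) ?eqxx //.
all: by apply: contraNneq mV => <-.
Qed.

(** * The contribution of a single ordering of D - a *)

Lemma sum_nat_card (n l r : nat) (P : pred nat) : (r <= n)%N ->
  (\sum_(l <= k < r) P k = #|[set i : 'I_n | (l <= i < r) && P i]|)%N.
Proof.
move=> rn; rewrite -sum1_card (eq_bigl _ _ (in_set _)).
rewrite -(big_mkord (fun i => (l <= i < r) && P i)%N (fun=> 1%N)).
rewrite (big_nat_widen _ _ _ _ _ rn) (big_nat_widenl _ 0%N) //.
rewrite [RHS]big_mkcond big_mkcond /=.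
by apply: eq_bigr => i _; case: (P i); case: (i < r)%N; case: (l <= i)%N.
Qed.

(** [delta_seq_insert] reduces each insertion to data at its gap, with a common factor from [u];
    [gap_sum_diff] then applies when there are at least two gaps. *)
Lemma gap_sum_OP (F : fieldType) (z : F) (D : digraph) (a m : nat) (u : seq nat) :
  z != 0 -> is_digraph D -> a \in verts D -> m \notin verts D ->
  (forall y, y \in verts D -> ~ reach_closed D a y -> (y < m)%N) ->
  s_lt_t D a -> u \in OP (del_vertex D a) -> (0 < size u)%N ->
  \sum_(pos_s D a u <= k < pos_t D a u) z ^+ delta_seq D (insert k a u)
  - \sum_(pos_s D a u <= k < pos_t D a u)
      z ^+ delta_seq (relabel D a m) (insert k m u) =
  (z - 1) ^+ 2 *
  (((p_coef D a u)%:~R + #|Q_set D a u|%:R * z^-1)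
   * z ^+ delta_seq (del_vertex D a) u).
Proof.
move=> z0 Dd aV mV m_gt st uO u_gt0.
have au := notin_OP_del _ _ _ uO.
have uV i : (i < size u)%N -> nth 0%N u i \in verts D.
  move=> iu; have : nth 0%N u i \in u by apply: mem_nth.
  by rewrite (mem_OP_del _ _ _ uO) in_fsetD1 => /andP[].
have mu : m \notin u.
  by rewrite (mem_OP_del _ _ _ uO) in_fsetD1 (negbTE mV) andbF.
have lt_st := st u uO.
have le_t := pos_t_le_size D a u.
have s_rel := pos_s_relabel _ _ m _ Dd mV aV uO.
have t_rel := pos_t_relabel _ _ m _ Dd mV aV uO.
set H := relabel D a m in s_rel t_rel *.
have del_H : del_vertex H m = del_vertex D a by apply: del_relabel.
have seqD : delta_seq D u = delta_seq (del_vertex D a) u by rewrite delta_seq_del.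
have seqH : delta_seq H u = delta_seq (del_vertex D a) u.
  by rewrite -del_H delta_seq_del.
have gapH k : (k <= size u)%N -> delta_gap H u k = delta_gap D u k.
  by move=> ku; rewrite -(delta_gap_del H m) // del_H delta_gap_del.
set s := pos_s D a u in lt_st s_rel *; set t := pos_t D a u in lt_st le_t t_rel *.
have no_in j : (s <= j < size u)%N -> arc D (nth 0%N u j) a = false.
  by move=> ju; apply/negbTE; have /pos_s_leP := leqnn s; apply.
have no_out j : (j < t.-1)%N -> arc D a (nth 0%N u j) = false.
  move=> jt; apply/negbTE; have := pos_t_gtP D a t.-1 u.
  by move=> /(_ _)/elimT; apply; lia.
have no_outH j : (j < t.-1)%N -> arc H m (nth 0%N u j) = false.
  move=> jt; apply/negbTE; have := pos_t_gtP H m t.-1 u; rewrite t_rel.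
  by move=> /(_ _)/elimT; apply; lia.
have lt_m j : (j < t.-1)%N -> (nth 0%N u j < m)%N.
  move=> jt; apply: m_gt; first by apply: uV; lia.
  by apply: not_reach_before_t => //; rewrite -/t; lia.
pose d k := (0 < delta_gap D u k)%N.
pose L k := (0 < delta_into D a u k)%N.
pose R k := (0 < delta_from D a u k.+1)%N.
have dE k : delta_gap D u k = d k.
  by rewrite /d /delta_gap /delta; case: ifP => // _; case: (_ || _).
have LE k : delta_into D a u k = L k.
  by rewrite /L /delta_into /delta; case: ifP => // _; case: (_ || _).
have RE k : delta_from D a u k.+1 = R k.
  by rewrite /R /delta_from /delta; case: ifP => // _; case: (_ || _).
(* The gap term that an insertion destroys becomes a division by [z ^+ d k], avoiding truncated
   subtraction of exponents. *)
have expD k : (s <= k < t)%N -> z ^+ delta_seq D (insert k a u) =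
    z ^+ (L k + R k) / z ^+ d k * z ^+ delta_seq (del_vertex D a) u.
  move=> kst; apply: (mulIf (expf_neq0 (d k) z0)).
  rewrite -exprD -{1}dE delta_seq_insert //; last lia.
  by rewrite LE RE seqD [LHS]exprD mulrC mulrAC divfK ?expf_neq0.
(* For [m] the left term is always 1, as a_k < m for k < t. The right term is 1 only at k = t - 1,
   through the arc to a_t or the convention for t = n. *)
have expH k : (s <= k < t)%N -> z ^+ delta_seq H (insert k m u) =
    z ^+ (1 + (k == t.-1)) / z ^+ d k * z ^+ delta_seq (del_vertex D a) u.
  move=> kst; apply: (mulIf (expf_neq0 (d k) z0)).
  rewrite -exprD -{1}dE -gapH ?delta_seq_insert //; try lia.
  have -> : delta_into H m u k = 1%N.
    rewrite /delta_into; case: k kst => //= k kst.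
    by rewrite /delta /entry /= lt_m //; lia.
  have -> : delta_from H m u k.+1 = (k == t.-1).
    rewrite /delta_from eqSS /delta /entry /=.
    case: (ltngtP k t.-1) kst => [kt _ | | kt _].
    - have -> : (k == size u) = false by apply/negbTE; lia.
      by rewrite no_outH // orbF ltnNge (ltnW (lt_m _ kt)).
    - by lia.
    case: eqP => // ku; have := pos_t_arc H m u; rewrite t_rel -kt => -> ; last lia.
    by rewrite orbT.
  by rewrite seqH [LHS]exprD mulrC mulrAC divfK ?expf_neq0.
rewrite (eq_big_nat _ _ expD) (eq_big_nat _ _ expH) -!mulr_suml -mulrBl mulrA.
congr (_ * _).
have Ls : L s.
  rewrite /L /delta_into; case: eqP => // s0.
  by rewrite /delta /entry pos_s_arc ?orbT // lt0n; apply/eqP.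
have Rt : R t.-1.
  rewrite /R /delta_from prednK; last lia.
  case: eqP => // t_neq; rewrite /delta /entry pos_t_arc ?orbT //; rewrite -/t; lia.
(* Strictly between s and t no arc joins a_k and [a], so both values depend only on comparing a_k
   with [a]. *)
have LR k : (s < k < t)%N -> L k = ~~ R k.-1.
  case: k => // k kst; rewrite /L /R /delta_into /delta_from /delta /entry /=.
  have -> : (k.+1 == (size u).+1) = false by apply/negbTE; lia.
  rewrite no_in ?no_out ?orbF; try lia.
  have : nth 0%N u k != a by apply: nth_neq => //; lia.
  by rewrite !lt0b; case: (ltngtP (nth 0%N u k) a).
(* Here a_k < a < a_(k+1). *)
have Ld k : (s < k < t.-1)%N -> L k -> R k -> d k.
  case: k => // k kst; have kN : (k.+1 == size u) = false by apply/negbTE; lia.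
  rewrite /L /R /d /delta_gap /delta_into /delta_from /delta /entry eqSS kN /=.
  by rewrite no_in ?no_out ?orbF; lia.
have ds : s.+1 = t -> d s.
  move=> s1t; rewrite /d /delta_gap; case: ifP => // /norP[s0 sN].
  by rewrite /delta arc_across ?orbT //; rewrite -/s; lia.
have t1 : s.+1 = t -> t.-1 = s by lia.
have t2 : s.+1 != t -> (s.+1 < t)%N /\ t.-1 = (t.-2).+1 by lia.
(* When a_k > a > a_(k+1), [d k] can only come from an arc. *)
have QE : #|Q_set D a u| = (\sum_(s.+1 <= k < t.-1) (~~ L k && ~~ R k && d k))%N.
  rewrite (@sum_nat_card (size u).+1); last lia.
  apply: eq_card => -[k ku] /=; rewrite !inE /= -/s -/t.
  case: (ltnP s k) => //= sk; have -> : (k.+1 < t)%N = (k < t.-1)%N by lia.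
  case: (ltnP k t.-1) => //= kt; case: k ku sk kt => // k ku sk kt.
  have kN : (k.+1 == size u) = false by apply/negbTE; lia.
  have k1 : nth 0%N u k != a by apply: nth_neq => //; lia.
  have k2 : nth 0%N u k.+1 != a by apply: nth_neq => //; lia.
  rewrite /L /R /d /delta_gap /delta_into /delta_from /delta /entry eqSS kN /=.
  by rewrite no_in ?no_out ?orbF; lia.
have pE : p_coef D a u = (1 - (d s)%:Z) * (R s)%:Z
    - (1 - (d t.-1)%:Z) * (delta_from D a u t.-1)%:Z.
  by rewrite /p_coef -/s -/t !dE RE.
have [s1t | /t2[lt_s1t {}t2]] := eqVneq s.+1 t; last first.
  rewrite gap_sum_diff // QE pE t2 RE -t2.
  by rewrite rmorphB !rmorphM !rmorphB /= -!pmulrn.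
(* With a single gap both sides vanish: [d s] is true, which kills both terms of [p_coef], including
   the junk value at t = 1. *)
rewrite pE QE t1 // ds //= !subrr mulr0z add0r.
rewrite [(\sum_(s.+1 <= _ < _) _)%N]big_geq // mulr0n mul0r mulr0.
rewrite -s1t !big_nat1 Ls /=.
by move: Rt; rewrite t1 // => ->; rewrite eqxx subrr.
Qed.

(** * Summation over the orderings of D - a *)

Theorem theorem3p1 (D : digraph) (a m : nat)
  (D_digraph : is_digraph D)
  (D_acyclic : acyclic D)
  (V_pos : forall v, v \in verts D -> (0 < v)%N)
  (n_ge3 : (3 <= #|` verts D|)%N)
  (aV : a \in verts D)
  (m_pos : (0 < m)%N)
  (mV : m \notin verts D)
  (m_gt : forall y, y \in verts D -> ~ reach_closed D a y -> (y < m)%N)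
  (st : s_lt_t D a) :
  let z : {fraction {poly int}} := tofrac 'X in
  tofrac (Delta D) - tofrac (Delta (relabel D a m)) =
  (z - 1) ^+ 2 *
  \sum_(u <- OP (del_vertex D a))
    ((p_coef D a u)%:~R + #|Q_set D a u|%:R * z^-1)
    * z ^+ delta_seq (del_vertex D a) u.
Proof.
move=> z; have z0 : z != 0 by rewrite tofrac_eq0 polyX_eq0.
have DeltaE H : tofrac (Delta H) = \sum_(w <- OP H) z ^+ delta_seq H w.
  by rewrite /Delta rmorph_sum; apply: eq_bigr => w _; rewrite rmorphXn.
have no_loop : ~~ arc D a a.
  by apply/negP => aa; have := D_acyclic [:: a]; rewrite /ucycle /= aa => /(_ isT).
have am : a != m by apply: contraNneq mV => <-.
have rva : relabel_vertex a m a = m by rewrite /relabel_vertex eqxx.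
have no_loop_m : ~~ arc (relabel D a m) m m.
  by rewrite -{2 3}rva arc_relabel.
have m_rel : m \in verts (relabel D a m) by apply/imfsetP; exists a.
rewrite !DeltaE (sum_OP_insert _ D a) // (sum_OP_insert _ (relabel D a m) m) //.
rewrite del_relabel // -sumrB mulr_sumr big_seq [RHS]big_seq.
apply: eq_bigr => u uO; rewrite pos_s_relabel // pos_t_relabel //.
apply: gap_sum_OP => //.
move: uO; rewrite mem_OP => /andP[/perm_size -> _].
(* The bound on n makes [u] nonempty, as the conventions at its ends require. *)
by move: n_ge3; rewrite (cardfsD1 a) aV add1n => /ltnW.
Qed.
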